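(* Let $G$ be an Abelian group (written additively) satisfying at least one of the following properties: (1) $G$ is countable; or (2) $G$ is a torsion group without elements of order $4$; or (3) $G$ has no elements of order $2$. Then $G\nrightarrow(2)_{\aleph_0}^{\cdot+\cdot}$.
   Context: For a commutative (additively written) semigroup $G$ and cardinal numbers $\kappa,\theta$, the symbol $G\rightarrow(\kappa)_\theta^{\cdot+\cdot}$ denotes the statement: for every colouring (i.e. function) $c:G\longrightarrow\theta$ there exists a subset $X\subseteq G$ with $|X|=\kappa$ such that $X+X$ is monochromatic (i.e. $c$ is constant on $X+X$), where $X+X=\{x+y \mid x,y\in X\}$; here $x=y$ is allowed, so $X+X$ contains all elements $2x$ with $x\in X$. The symbol $G\nrightarrow(\kappa)_\theta^{\cdot+\cdot}$ denotes the negation of this statement. Countable means finite or countably infinite. *)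

(* Defs.v *)
From HB Require Import structures.
From mathcomp Require Import all_boot all_order all_algebra.
From mathcomp Require Import boolp classical_sets functions cardinality.

Set Implicit Arguments.
Unset Strict Implicit.
Unset Printing Implicit Defensive.

Import GRing.Theory.

Local Open Scope classical_set_scope.
Local Open Scope card_scope.
Local Open Scope ring_scope.

Definition sumset (G : addSemigroupType) (X : set G) : set G :=
  [set x + y | x in X & y in X].

Definition monochromatic (T C : Type) (c : T -> C) (A : set T) : Prop :=
  forall a b, A a -> A b -> c a = c b.

(* The partition relation G -> (kappa)_theta^{.+.}. Cardinals are represented
   by types; |X| = kappa is equinumerosity of X with the full set of kappa.
   [addSemigroupType] is the structure of commutative semigroups. *)
Definition sum_arrow (G : addSemigroupType) (kappa theta : Type) : Prop :=
  forall c : G -> theta,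
    exists X : set G, X #= [set: kappa] /\ monochromatic c (sumset X).

Definition has_add_order (G : zmodType) (x : G) (n : nat) : Prop :=
  [/\ (0 < n)%N, x *+ n = 0
    & forall m : nat, (0 < m)%N -> (m < n)%N -> x *+ m <> 0].

Definition torsion_group (G : zmodType) : Prop :=
  forall x : G, exists n : nat, has_add_order x n.

(* Main.v *)
Require Import Defs.
From mathcomp Require Import all_boot all_order all_algebra.
From mathcomp Require Import boolp classical_sets functions cardinality.

(** An injective colouring settles the countable case. In the other two cases
    [G] has no element of order 4, so [A := 2G] has no element of order 2. If
    [X = {x, y}], then [2x], [x + y], [2y] is a three-term progression; its
    ends lie in [A], and so does its middle if elements outside [A] get a
    separate colour. It thus suffices to colour [A] with countably many
    colours without monochromatic nontrivial three-term progressions. By Zorn's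
    lemma take a maximal such colouring on a subgroup [H] of [A] such that
    [A / H] has no 2-torsion. If [x] is in [A] but not in [H], then the
    preimage [K] in [A] of the [2]-divisible hull of [x] in [A / H] has
    countable [K / H], and an element of [K] outside [H] is coloured by its
    coset followed by the colour of its difference with a fixed representative
    of that coset. *)

Set Implicit Arguments.
Unset Strict Implicit.
Unset Printing Implicit Defensive.

Import GRing.Theory.

Local Open Scope classical_set_scope.
Local Open Scope ring_scope.

(** * Subgroups and colourings without three-term progressions *)

Definition subgroup (G : zmodType) (H : set G) : Prop :=
  H 0 /\ forall x y, H x -> H y -> H (x - y).

Definition no_ap3 (G : zmodType) (C : Type) (H : set G) (c : G -> C) : Prop :=
  forall a m b, H a -> H m -> H b -> m - a = b - m ->
    c a = c m -> c m = c b -> a = m.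

(** For a subgroup [H] of [A], this says that [A / H] has no 2-torsion. *)
Definition half_closed (G : zmodType) (A H : set G) : Prop :=
  forall g, A g -> H (g *+ 2) -> H g.

Section Subgroup.
Variables (G : zmodType) (H : set G).
Hypothesis subH : subgroup H.

Lemma subgroupN x : H x -> H (- x).
Proof. by rewrite -sub0r; apply: subH.2; exact: subH.1. Qed.

Lemma subgroupD x y : H x -> H y -> H (x + y).
Proof. by move=> Hx /subgroupN; rewrite -{2}[y]opprK; apply: subH.2. Qed.

Lemma subgroupMn x n : H x -> H (x *+ n).
Proof.
move=> Hx; elim: n => [|n IHn]; first exact: subH.1.
by rewrite mulrS; exact: subgroupD.
Qed.

Lemma subgroup_subl x y : H (x - y) -> H x -> H y.
Proof. by move=> Hxy Hx; rewrite -[y](subKr x); apply: subH.2. Qed.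

Lemma subgroup_subr x y : H (x - y) -> H y -> H x.
Proof. by move=> Hxy Hy; rewrite -[x](subrK y); apply: subgroupD. Qed.

End Subgroup.

Lemma half_closed_iter (G : zmodType) (A H : set G) g k :
  subgroup A -> half_closed A H -> A g -> H (g *+ 2 ^ k) -> H g.
Proof.
move=> sA hH; elim: k g => // k IHk g Ag; rewrite expnS mulrnA => Hg.
by apply: hH => //; apply: IHk Hg; exact: subgroupMn.
Qed.

(** * Extending a colouring from [H] to a subgroup containing [x] *)

Section Extension.
Variables (G : zmodType) (A H : set G) (x : G).
Hypotheses (sA : subgroup A) (sH : subgroup H) (HA : H `<=` A).
Hypotheses (hH : half_closed A H) (Ax : A x).

(* As [A / H] has no 2-torsion, [fib (k, n)] is empty or a single coset of
   [H]: the one of [(n / 2^k) x]. *)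
Let fib (p : nat * int) : set G :=
  [set g | A g /\ H (g *+ 2 ^ p.1 - x *~ p.2)].

Definition hull : set G := [set g | exists p, fib p g].

Let coset_index (g : G) : nat * int := xget (0%N, 0) [set p | fib p g].

Let coset_repr (p : nat * int) : G := xget 0 (fib p).

(** The multiples of [x] cancel, so [(g - h) *+ 2 ^ p.1] lies in [H], and [hH] removes the
    doublings. *)
Lemma fib_sub p g h : fib p g -> fib p h -> H (g - h).
Proof.
move=> [Ag Hg] [Ah Hh]; apply: (half_closed_iter sA hH (k := p.1)).
  exact: sA.2.
by have := sH.2 _ _ Hg Hh; rewrite opprB subrKA mulrnBl.
Qed.

Lemma fib_index g : hull g -> fib (coset_index g) g.
Proof. by move=> Kg; apply: (xgetPex (0%N, 0) (P := [set p | fib p g])). Qed.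

Lemma fib_repr g : hull g -> fib (coset_index g) (coset_repr (coset_index g)).
Proof. by move=> Kg; apply: xgetPex; exists g; exact: fib_index. Qed.

Lemma subset_hull : H `<=` hull.
Proof.
move=> g Hg; exists (0%N, 0); split; first exact: HA.
by rewrite /= mulr0z subr0.
Qed.

Lemma mem_hull : hull x.
Proof.
by exists (0%N, 1); split=> //=; rewrite mulr1z subrr; exact: sH.1.
Qed.

Lemma hull_subgroup : subgroup hull.
Proof.
split; first exact: subset_hull sH.1.
move=> g h [[k n] [Ag /= Hg]] [[l m] [Ah /= Hh]].
(* Subtraction of [n / 2^k] and [m / 2^l] over the denominator [2^(k + l)]. *)
exists ((k + l)%N, n * (2 ^ l)%N%:Z - m * (2 ^ k)%N%:Z).
split; first exact: sA.2.
have := sH.2 _ _ (subgroupMn sH (2 ^ l) Hg) (subgroupMn sH (2 ^ k) Hh).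
rewrite /= mulrzBr !mulrzA -!pmulrn !mulrnBl -!mulrnA -!expnD [(l + k)%N]addnC.
by rewrite !opprB [x *~ m *+ _ - _]addrC [x *~ m *+ _ - _]addrC addrACA.
Qed.

Lemma hull_half_closed : half_closed A hull.
Proof.
move=> g Ag [[k n] [A2g H2g]]; exists (k.+1, n); split=> //=.
by rewrite expnS mulrnA.
Qed.

Variable c : G -> seq (nat * int).
Hypothesis cH : no_ap3 H c.

(** Lists let every extension prepend one more index within a fixed countable type. *)
Definition hull_colouring (g : G) : seq (nat * int) :=
  if pselect (H g) then c g
  else coset_index g :: c (g - coset_repr (coset_index g)).

Lemma hull_colouring_in g : H g -> hull_colouring g = c g.
Proof. by rewrite /hull_colouring; case: pselect. Qed.

Lemma hull_colouring_out g : ~ H g ->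
  hull_colouring g = coset_index g :: c (g - coset_repr (coset_index g)).
Proof. by rewrite /hull_colouring; case: pselect. Qed.

(** The equivalence excludes the mixed case, where an unprefixed colour could equal a prefixed
    one. *)
Lemma hull_colouring_sub g h : hull g -> hull h -> (H g <-> H h) ->
  hull_colouring g = hull_colouring h -> H (g - h).
Proof.
move=> Kg Kh Hgh; case: (pselect (H g)) => Hg.
  by move=> _; apply: sH.2 => //; apply/Hgh.
rewrite !hull_colouring_out -?Hgh // => -[e _].
by apply: fib_sub (fib_index Kg) _; rewrite e; exact: fib_index.
Qed.

(** The progression first turns out to lie in one coset of [H]; outside [H], subtracting the
    representative carries it into [H], where [cH] applies. *)
Lemma no_ap3_hull : no_ap3 hull hull_colouring.
Proof.
move=> a m b Ka Km Kb ap cam cmb.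
have Ama : A (m - a) by case: Ka Km => ? [Aa _] [? [Am _]]; exact: sA.2.
have Hma : H (m - a).
  (* Two of the three points are both in [H] or both outside. *)
  have [Hama|[Hmb|Hab]] : (H m <-> H a) \/ (H b <-> H m) \/ (H b <-> H a).
    by have [? ? ?] := And3 (EM (H a)) (EM (H m)) (EM (H b)); tauto.
  - exact: hull_colouring_sub.
  - by rewrite ap; exact: hull_colouring_sub.
  apply: hH => //; rewrite mulr2n {1}ap addrA subrK.
  by apply: hull_colouring_sub => //; rewrite -cmb.
have Hbm : H (b - m) by rewrite -ap.
case: (pselect (H m)) => Hm.
  have Ha := subgroup_subl sH Hma Hm; have Hb := subgroup_subr sH Hbm Hm.
  by rewrite !hull_colouring_in // in cam cmb; exact: cH cam cmb.
have Ha : ~ H a by move=> /(subgroup_subr sH Hma).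
have Hb : ~ H b by move=> /(subgroup_subl sH Hbm).
rewrite !hull_colouring_out // in cam cmb.
case: cam cmb => eam cam [emb cmb]; rewrite -emb eam in cam cmb.
set r := coset_repr _ in cam cmb.
have Hr g : hull g -> coset_index g = coset_index m -> H (g - r).
  by move=> Kg e; apply: fib_sub (fib_repr Km); rewrite -e; exact: fib_index.
apply/(addIr (- r))/(cH (b := b - r)) => //; try exact: Hr.
by rewrite !opprB !subrKA.
Qed.

End Extension.

(** * Maximal colourings by Zorn's lemma *)

Section Zorn.
Variables (G : zmodType) (A : set G).
Hypotheses (sA : subgroup A) (tfA : forall g, A g -> g *+ 2 = 0 -> g = 0).

Let colouring := (set G * (G -> seq (nat * int)))%type.

Let good (p : colouring) : Prop :=
  [/\ subgroup p.1, p.1 `<=` A, half_closed A p.1 & no_ap3 p.1 p.2].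

(** Values off the subgroup are irrelevant, so this is a preorder, not an order. *)
Let extends (p q : colouring) : Prop :=
  p.1 `<=` q.1 /\ forall g, p.1 g -> q.2 g = p.2 g.

Lemma good0 : good ([set 0], fun=> [::]).
Proof.
split=> /=; first by split=> // x y -> ->; rewrite subr0.
- by move=> _ ->; exact: sA.1.
- exact: tfA.
- by move=> a m b -> ->.
Qed.

(** Each condition involves at most three points of the union, and these lie in a common member of
    the chain. *)
Lemma chain_union (S : set colouring) : S !=set0 -> S `<=` good ->
  (forall p q, S p -> S q -> extends p q \/ extends q p) ->
  exists2 u, good u & forall p, S p -> extends p u.
Proof.
move=> [p0 Sp0] Sgood Stot.
have [c cP] : exists c : G -> seq (nat * int),
    forall g p, S p -> p.1 g -> c g = p.2 g.
  suff /choice[c cP] g : exists v, forall p, S p -> p.1 g -> v = p.2 g.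
    by exists c.
  have [[p Sp pg]|no] := pselect (exists2 p, S p & p.1 g); last first.
    by exists [::] => p Sp pg; case: no; exists p.
  exists (p.2 g) => q Sq qg.
  by have [[_ ->]|[_ ->]] := Stot p q Sp Sq.
pose U : set G := [set g | exists2 p, S p & p.1 g].
have U2 g h : U g -> U h -> exists2 p, S p & p.1 g /\ p.1 h.
  move=> [p Sp pg] [q Sq qh].
  have [[s _]|[s _]] := Stot p q Sp Sq; [exists q|exists p] => //.
    by split=> //; exact: s.
  by split=> //; exact: s.
have U3 g h k : U g -> U h -> U k -> exists p, [/\ S p, p.1 g, p.1 h & p.1 k].
  move=> Ug Uh [q Sq qk]; have [p Sp [pg ph]] := U2 _ _ Ug Uh.
  have [[s _]|[s _]] := Stot p q Sp Sq; [exists q|exists p].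
    by split=> //; exact: s.
  by split=> //; exact: s.
exists (U, c); last by move=> p Sp; split=> [g pg|g]; [exists p|exact: cP].
split=> /=.
- split; first by exists p0 => //; have [[]] := Sgood _ Sp0.
  move=> x y Ux Uy; have [p Sp [px py]] := U2 _ _ Ux Uy.
  by exists p => //; have [[_ sp] _ _ _] := Sgood _ Sp; exact: sp.
- by move=> g [p Sp]; have [_ + _ _] := Sgood _ Sp; exact.
- by move=> g Ag [p Sp pg]; exists p => //; have [_ _ + _] := Sgood _ Sp; exact.
- move=> a m b Ua Um Ub ap.
  have [p [Sp pa pm pb]] := U3 _ _ _ Ua Um Ub.
  rewrite !(cP _ p) //; have [_ _ _ h] := Sgood _ Sp; exact: h ap.
Qed.

Lemma exists_no_ap3 : exists c : G -> seq (nat * int), no_ap3 A c.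
Proof.
pose T := {p : colouring | good p}.
pose R (s t : T) : bool := `[< extends (sval s) (sval t) >].
have [||chain|[[H c] /= [sH HA hH cH]] maxH] :=
    @ZL_preorder T (exist _ _ good0) R.
- by move=> t; apply/asboolP; split.
- move=> r s t /asboolP[rs1 rs2] /asboolP[st1 st2]; apply/asboolP.
  split=> [g /rs1 /st1//|g rg]; rewrite st2 ?rs2 //; exact: rs1.
- move=> tot; have [[t0 ct0]|no] := pselect (chain !=set0); last first.
    by exists (exist _ _ good0) => s cs; case: no; exists s.
  have [||p q [s cs <-] [t ct <-]|u gu uP] := @chain_union (sval @` chain).
  + by exists (sval t0); exists t0.
  + by move=> _ [t _ <-]; exact: (svalP t).
  + by have [/asboolP|/asboolP] := tot _ _ cs ct; [left|right].
  by exists (exist _ u gu) => s cs; apply/asboolP/uP; exists s.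
exists c; suff AH : A `<=` H.
  by move=> a m b /AH + /AH + /AH; exact: cH.
(* The hull contains [x], and maximality puts it inside [H]. *)
move=> x Ax; have gK : good (hull A H x, hull_colouring A H x c).
  split=> /=.
  - exact: hull_subgroup.
  - by move=> g [p []].
  - exact: hull_half_closed.
  - exact: no_ap3_hull.
have /asboolP[+ _] : R (exist _ _ gK) (exist _ (H, c) (And4 sH HA hH cH)).
  apply: maxH; apply/asboolP; split=> /=; first exact: subset_hull.
  by move=> g; exact: hull_colouring_in.
by apply; exact: mem_hull.
Qed.

End Zorn.

(** * From progressions back to sumsets *)

Lemma mulr4n_eq0 (G : zmodType) (x : G) :
  ~ has_add_order x 4 -> x *+ 4 = 0 -> x *+ 2 = 0.
Proof.
move=> no4 x4; apply: contrapT => x2; apply: no4.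
(* An [m] of 1, 2 or 3 would force [x *+ 2 = 0]; for 3, [x *+ 4 = 0] gives [x = 0]. *)
split=> // -[|[|[|[|]]]] // _ _.
  by move=> x1; apply: x2; rewrite mulr2n -[x]mulr1n x1 addr0.
by move=> x3; apply: x2; move: x4; rewrite mulrSr x3 add0r => ->; exact: mul0rn.
Qed.

Lemma sum_arrow2_distinct (G : zmodType) (C : Type) (c : G -> C) :
  sum_arrow G 'I_2 C ->
  exists x y : G, [/\ x <> y, c (x *+ 2) = c (x + y) & c (x + y) = c (y *+ 2)].
Proof.
move=> /(_ c) [X [cX mono]].
have [f [_ _ fsurj]] := card_set_bijP (card_eq_trans cX (card_esym card_II)).
have [x Xx fx] := fsurj 0%N isT; have [y Xy fy] := fsurj 1%N isT.
have sumX u v : X u -> X v -> sumset X (u + v).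
  by move=> Xu Xv; exists u => //; exists v.
exists x, y; rewrite !mulr2n; split.
- by move=> xy; move: fy; rewrite -xy fx.
- by apply: mono; exact: sumX.
- by apply: mono; exact: sumX.
Qed.

Lemma countable_sum_not_arrow (G : zmodType) :
  countable [set: G] -> ~ sum_arrow G 'I_2 nat.
Proof.
move=> /countable_injP[c cinj] /(sum_arrow2_distinct c)[x [y [xy + _]]].
move=> /cinj; rewrite !inE => /(_ I I); rewrite mulr2n => /addrI; exact: xy.
Qed.

Lemma no_order4_sum_not_arrow (G : zmodType) :
  (forall x : G, ~ has_add_order x 4) -> ~ sum_arrow G 'I_2 nat.
Proof.
move=> no4; pose A : set G := [set x *+ 2 | x in [set: G]].
have sA : subgroup A.
  split; first by exists 0 => //; rewrite mul0rn.
  by move=> _ _ [x _ <-] [y _ <-]; exists (x - y) => //; rewrite mulrnBl.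
have [|c cA] := exists_no_ap3 sA.
  by move=> _ [x _ <-]; rewrite -mulrnA; exact: mulr4n_eq0.
(* The successor reserves 0 for elements outside [A], so a sum coloured like [x *+ 2] lies in
   [A]. *)
pose d (g : G) := if `[<A g>] then (pickle (c g)).+1 else 0%N.
move=> /(sum_arrow2_distinct d)[x [y [xy]]].
have A2 z : `[<A (z *+ 2)>] by apply/asboolP; exists z.
rewrite /d !A2; case: asboolP => // Axy [/(pcan_inj pickleK) cxy].
move=> [/(pcan_inj pickleK) cyx].
apply: xy; apply: (addrI x); rewrite -mulr2n.
apply: cA cxy cyx => //; try exact/asboolP.
by rewrite !mulr2n [x + y]addrC !addrKA.
Qed.

Theorem theorem6 (G : zmodType)
  (hG : countable [set: G]%classic
        \/ (torsion_group G /\ ~ (exists x : G, has_add_order x 4))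
        \/ ~ (exists x : G, has_add_order x 2)) :
  ~ sum_arrow G 'I_2 nat.
Proof.
case: hG => [|[[_ no4]|no2]]; first exact: countable_sum_not_arrow.
  by apply: no_order4_sum_not_arrow => x x4; apply: no4; exists x.
(* If [x] has order 4, then [x *+ 2] has order 2. *)
apply: no_order4_sum_not_arrow => x [_ x4 xmin]; apply: no2; exists (x *+ 2).
split=> // [|[|[|]] // _ _]; first by rewrite -mulrnA.
by rewrite mulr1n; exact: xmin.
Qed.
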